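(* $F_0^{W_3}(q)=1$, and for $n\geq 2$, $$F_{2n-2}^{W_3}(q)=(q^{n-1}+1)F_{2n-4}^{W_3}(q)+\sum_{k=2}^{n-1}q^{k(n-k)+\binom{n-k}{2}}F_{2k-4}^{W_3}(q).$$
   Context: $S_n(132,3412)$ is the set of permutations of $[n]$ containing no subsequence order isomorphic to $132$ and none order isomorphic to $3412$. $inv(\sigma)$ is the number of inversions of $\sigma$. For $n\geq 1$ define $F_{2n-2}^{W_3}(q)=\sum_{\sigma\in S_n(132,3412)}q^{inv(\sigma)}$. *)

(* Defs.v *)
From mathcomp Require Import all_boot all_order all_algebra all_fingroup.

Set Implicit Arguments.
Unset Strict Implicit.
Unset Printing Implicit Defensive.

Import GRing.Theory.
Local Open Scope ring_scope.

(* A permutation of [n] is an s : 'S_n, read in one-line notation as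
   s 0, ..., s (n - 1): positions and values are numbered from 0, whereas
   patterns keep their usual letters 1, ..., k.  Only comparisons between
   letters matter, so the shift is harmless. *)

(* f lists the increasing positions of a subsequence of s. *)
Definition contains_pattern (n k : nat) (t : k.-tuple nat) (s : 'S_n) : bool :=
  [exists f : {ffun 'I_k -> 'I_n},
     [forall i : 'I_k, forall j : 'I_k, (i < j)%N ==> (f i < f j)%N] &&
     [forall i : 'I_k, forall j : 'I_k,
        (s (f i) < s (f j))%N == (tnth t i < tnth t j)%N]].

Definition avoids_pattern (n k : nat) (t : k.-tuple nat) (s : 'S_n) : bool :=
  ~~ contains_pattern t s.

Definition pattern132 : 3.-tuple nat := [tuple 1%N; 3%N; 2%N].
Definition pattern3412 : 4.-tuple nat := [tuple 3%N; 4%N; 1%N; 2%N].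

Definition avoiders_W3 (n : nat) : {set 'S_n} :=
  [set s : 'S_n | avoids_pattern pattern132 s & avoids_pattern pattern3412 s].

Definition inv (n : nat) (s : 'S_n) : nat :=
  #|[set p : 'I_n * 'I_n | (p.1 < p.2)%N && (s p.2 < s p.1)%N]|.

(* F_W3 n is the polynomial $F_{2n-2}^{W_3}(q)$, with q = 'X; it is meant for
   n >= 1 only.  Thus $F_{2n-4}^{W_3}$ is F_W3 (n - 1). *)
Definition F_W3 (n : nat) : {poly int} :=
  \sum_(s in avoiders_W3 n) 'X^(inv s).

(* Main.v *)
(* In one-line notation, write a permutation as u n v, where n is the maximum.
   It avoids 132 and 3412 iff u and v do, every letter of u exceeds every
   letter of v, and v is decreasing unless u is empty.  If u is empty then v is
   arbitrary and n contributes n - 1 inversions; if v is empty then u is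
   arbitrary and n contributes none; otherwise, with k the position of n, v is
   the decreasing word on 1, ..., n - k, which contributes binomial(n - k, 2)
   inversions, and each of the k letters of u n exceeds all n - k letters of
   v. *)

Require Import Defs.
From mathcomp Require Import all_boot all_order all_algebra all_fingroup.
From mathcomp Require Import zify.

Import GRing.Theory.
Local Open Scope ring_scope.

Set Implicit Arguments.
Unset Strict Implicit.
Unset Printing Implicit Defensive.

(** * Order isomorphism and pattern occurrence in words *)

Section Words.
Local Open Scope nat_scope.
Implicit Types (t u v w : seq nat) (x y z : nat).

(** The sizes agree and all indices stay below [size t], so the default 0 of [nth] is never read. *)
Definition order_iso t u : bool :=
  (size u == size t) &&
  all (fun i => all (fun j => (nth 0 u i < nth 0 u j) == (nth 0 t i < nth 0 t j))
         (iota 0 (size t))) (iota 0 (size t)).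

Lemma order_isoP t u :
  reflect (size u = size t /\
           forall i j, i < size t -> j < size t ->
             (nth 0 u i < nth 0 u j) = (nth 0 t i < nth 0 t j))
          (order_iso t u).
Proof.
apply: (iffP andP) => [[/eqP su /allP H]|[su H]]; split.
- exact: su.
- move=> i j lti ltj.
  have/allP Hi := H i ltac:(by rewrite mem_iota).
  by apply: (eqP (Hi j _)); rewrite mem_iota.
- exact/eqP.
- apply/allP => i; rewrite mem_iota /= => lti.
  by apply/allP => j; rewrite mem_iota /= => ltj; rewrite H.
Qed.

(** Masks of length [size w] are finitely many, which makes occurrence a boolean; [occursP] returns
    to subsequences. *)
Definition occurs t w : bool :=
  [exists m : (size w).-tuple bool, order_iso t (mask m w)].

Lemma occursP t w :
  reflect (exists2 u, subseq u w & order_iso t u) (occurs t w).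
Proof.
apply: (iffP existsP) => [[m tm]|[u /subseqP[m /eqP sm ->] tu]].
  by exists (mask m w) => //; apply: mask_subseq.
by exists (Tuple sm).
Qed.

Lemma occursPn t w :
  reflect (forall u, subseq u w -> ~~ order_iso t u) (~~ occurs t w).
Proof.
apply: (iffP idP) => [H u uw|H].
  by apply: contra H => tu; apply/occursP; exists u.
by apply/occursP => -[u /H/negP].
Qed.

Lemma order_iso_map c t u : order_iso t (map (addn c) u) = order_iso t u.
Proof.
apply/order_isoP/order_isoP; rewrite size_map => -[su H]; split=> // i j lti ltj.
  by have := H i j lti ltj; rewrite !(nth_map 0) ?su // ltn_add2l.
by rewrite !(nth_map 0) ?su // ltn_add2l; apply: H.
Qed.

Lemma occurs_map_add c t w : occurs t (map (addn c) w) = occurs t w.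
Proof.
rewrite /occurs size_map; apply: eq_existsb => m.
by rewrite -map_mask order_iso_map.
Qed.

Lemma subseq_occursN {t u w} : subseq u w -> ~~ occurs t w -> ~~ occurs t u.
Proof.
move=> uw /occursPn H; apply/occursPn => p pu.
exact/H/(subseq_trans pu).
Qed.

Lemma subseq_cat_split p u v :
  subseq p (u ++ v) ->
  exists p1 p2, [/\ p = p1 ++ p2, subseq p1 u & subseq p2 v].
Proof.
case/subseqP => m sm ->; rewrite size_cat in sm.
exists (mask (take (size u) m) u), (mask (drop (size u) m) v).
rewrite -{1}(cat_take_drop (size u) m) mask_cat ?mask_subseq //.
by rewrite size_takel // sm leq_addr.
Qed.

(** * Words avoiding 132 and 3412 *)

Notation p132 := [:: 1; 3; 2].
Notation p3412 := [:: 3; 4; 1; 2].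

Lemma order_iso132 u :
  order_iso p132 u -> exists x y z, u = [:: x; y; z] /\ x < z < y.
Proof.
case: u => [|x [|y [|z [|? ?]]]] //=; rewrite /order_iso //= => H.
by exists x, y, z; split=> //; lia.
Qed.

Lemma iso132 x y z : x < z < y -> order_iso p132 [:: x; y; z].
Proof. by rewrite /order_iso /=; lia. Qed.

Lemma order_iso3412 u : order_iso p3412 u ->
  exists x y z a, u = [:: x; y; z; a] /\ [&& z < a, a < x & x < y].
Proof.
case: u => [|x [|y [|z [|a [|? ?]]]]] //=; rewrite /order_iso //= => H.
by exists x, y, z, a; split=> //; lia.
Qed.

Lemma iso3412 x y z a :
  z < a -> a < x -> x < y -> order_iso p3412 [:: x; y; z; a].
Proof. by rewrite /order_iso /=; lia. Qed.

Definition avoiding w : bool := ~~ occurs p132 w && ~~ occurs p3412 w.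

Lemma subseq_avoiding {u w} : subseq u w -> avoiding w -> avoiding u.
Proof. by move=> uw /andP[H K]; rewrite /avoiding !(subseq_occursN uw). Qed.

Lemma avoiding_map_add c w : avoiding (map (addn c) w) = avoiding w.
Proof. by rewrite /avoiding !occurs_map_add. Qed.

Lemma sorted_gtn_avoiding w : sorted gtn w -> avoiding w.
Proof.
have gt_trans : transitive gtn by move=> ? ? ? /=; lia.
move=> sw; apply/andP; split; apply/occursPn => p pw; apply/negP.
  move/order_iso132 => [x [y [z [E ?]]]]; subst p.
  by have := subseq_sorted gt_trans pw sw => /=; lia.
move/order_iso3412 => [x [y [z [a [E ?]]]]]; subst p.
by have := subseq_sorted gt_trans pw sw => /=; lia.
Qed.

(** An occurrence is cut into a prefix from [u] and a suffix from [n :: v]. One inside [u] is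
    excluded by hypothesis; one inside [n :: v] lies in [v], since neither pattern begins with its
    largest letter. The remaining cuts contradict the bounds between [u], [v] and [n] or, for 3412,
    the descent of [v]. *)
Lemma avoiding_cat_max n u v :
  (forall x, x \in u -> x < n) -> (forall x, x \in v -> x < n) ->
  (forall x y, x \in u -> y \in v -> y < x) ->
  avoiding u -> avoiding v -> (u = [::] \/ sorted gtn v) ->
  avoiding (u ++ n :: v).
Proof.
have gt_trans : transitive gtn by move=> ? ? ? /=; lia.
move=> un vn uv /andP[/occursPn u132 /occursPn u3412].
move=> /andP[/occursPn v132 /occursPn v3412] dec.
have nv x : x \in n :: v -> x = n \/ x \in v by rewrite inE => /orP[/eqP|]; auto.
apply/andP; split; apply/occursPn => p /subseq_cat_split [p1 [p2 [-> s1 s2]]];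
    apply/negP => iso.
- have [x [y [z [E ltn3]]]] := order_iso132 iso.
  move: iso E s1.
  (* The cases count the letters of 132 taken from [u]. *)
  case: p1 => [|a [|b [|c [|? ?]]]] iso //= E s1; try by case: E.
  + rewrite E in iso s2; move: s2 => /=; case: eqP => [xn|_ s2].
      move=> s2; have/vn : z \in v by apply: (mem_subseq s2); rewrite !inE eqxx orbT.
      by lia.
    by have/negP := v132 _ s2; apply.
  + case: E => ax E; rewrite E in s2; subst a.
    have xu : x \in u by apply: (mem_subseq s1); rewrite inE.
    have /nv yv' : y \in n :: v by apply: (mem_subseq s2); rewrite !inE eqxx.
    have /nv zv' : z \in n :: v by apply: (mem_subseq s2); rewrite !inE eqxx orbT.
    case: yv' zv' => [?|yv] [?|zv]; try lia.
    * by have := uv _ _ xu zv; lia.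
    * by have := vn _ yv; lia.
    * by have := uv _ _ xu zv; lia.
  + case: E => ax bY E; rewrite E in s2; subst a b.
    have xu : x \in u by apply: (mem_subseq s1); rewrite inE eqxx.
    have/un yu : y \in u by apply: (mem_subseq s1); rewrite !inE eqxx orbT.
    have /nv : z \in n :: v by apply: (mem_subseq s2); rewrite inE.
    case=> [?|zv]; first lia.
    by have := uv _ _ xu zv; lia.
  + case: E => ? ? ? E; subst.
    by have/negP := u132 _ s1; apply.
- have [x [y [z [a [E /and3P[lt1 lt2 lt3]]]]]] := order_iso3412 iso.
  move: iso E s1.
  case: p1 => [|b [|c [|d [|e [|? ?]]]]] iso //= E s1; try by case: E.
  + rewrite E in iso s2; move: s2 => /=; case: eqP => [xn|_ s2].
      move=> s2; have/vn : y \in v by apply: (mem_subseq s2); rewrite !inE eqxx.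
      by lia.
    by have/negP := v3412 _ s2; apply.
  + case: E => bx E; rewrite E in s2; subst b.
    have xu : x \in u by apply: (mem_subseq s1); rewrite inE.
    (* Either the 4 is [n] and the letters 1, 2 form an ascent in [v], or the 4 lies in [v] although
       it exceeds a letter of [u]. *)
    case: dec xu => [->//|sv] xu; move: s2 => /=; case: eqP => [_|_] s2.
      by have /= := subseq_sorted gt_trans s2 sv; lia.
    have yv : y \in v by apply: (mem_subseq s2); rewrite inE eqxx.
    by have := uv _ _ xu yv; lia.
  + case: E => bx cy E; rewrite E in s2; subst b c.
    have xu : x \in u by apply: (mem_subseq s1); rewrite inE eqxx.
    have xn := un _ xu.
    (* With 3 and 4 in [u], the letter 1 is not [n], so 1 and 2 form an ascent in [v]. *)
    case: dec xu => [->//|sv] xu; move: s2 => /=; case: eqP => [?|_] s2; first lia.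
    by have /= := subseq_sorted gt_trans s2 sv; lia.
  + case: E => bx cy dz E; rewrite E in s2; subst b c d.
    have/un xn : x \in u by apply: (mem_subseq s1); rewrite inE eqxx.
    have zu : z \in u by apply: (mem_subseq s1); rewrite !inE eqxx !orbT.
    have /nv : a \in n :: v by apply: (mem_subseq s2); rewrite inE.
    case=> [?|av]; first lia.
    by have := uv _ _ zu av; lia.
  + case: E => ? ? ? ? E; subst.
    by have/negP := u3412 _ s1; apply.
Qed.

(** * Avoiding words on 0, ..., n - 1 and their decomposition at the maximum *)

Definition words n : seq (seq nat) :=
  [seq w <- permutations (iota 0 n) | avoiding w].

Lemma mem_words n w : (w \in words n) = perm_eq w (iota 0 n) && avoiding w.
Proof. by rewrite mem_filter mem_permutations andbC. Qed.

Lemma words_uniq n : uniq (words n).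
Proof. exact/filter_uniq/permutations_uniq. Qed.

Lemma size_word n w : w \in words n -> size w = n.
Proof. by rewrite mem_words => /andP[/perm_size ->]; rewrite size_iota. Qed.

Lemma ltn_word n w x : w \in words n -> x \in w -> x < n.
Proof. by rewrite mem_words => /andP[/perm_mem -> _]; rewrite mem_iota. Qed.

Lemma perm_cat_max n u v :
  perm_eq (u ++ n :: v) (iota 0 n.+1) = perm_eq (u ++ v) (iota 0 n).
Proof.
rewrite -addn1 iotaD /= add0n.
rewrite (perm_catCA u [:: n] v) perm_sym (perm_catC _ [:: n]) perm_sym.
exact: perm_cons.
Qed.

(** Turns a condition on two-letter subsequences into a sorting condition; it serves to show that
    [v] is decreasing. *)
Lemma pairwise_subseq2 (r : rel nat) w :
  (forall x y, subseq [:: x; y] w -> r x y) -> pairwise r w.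
Proof.
elim: w => [//|a w IHw] H; apply/andP; split.
  by apply/allP => y yw; apply: H; rewrite /= eqxx sub1seq.
by apply: IHw => x y xy; apply: H; apply: subseq_trans xy (subseq_cons _ _).
Qed.

(* The patterns involving the maximum n are x n y with x < y, and x n y z
   with y < z < x. *)
Lemma mem_words_cat n u v :
  u ++ n :: v \in words n.+1 <->
  [/\ perm_eq (u ++ v) (iota 0 n), avoiding u, avoiding v,
      forall x y, x \in u -> y \in v -> y < x & u = [::] \/ sorted gtn v].
Proof.
rewrite mem_words perm_cat_max; split=> [/andP[uv av]|[uv au av ltvu dec]].
  have lt x : x \in u ++ v -> x < n by rewrite (perm_mem uv) mem_iota.
  have uniq_uv : uniq (u ++ v) by rewrite (perm_uniq uv) iota_uniq.
  have ltvu x y : x \in u -> y \in v -> y < x.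
    move=> xu yv; rewrite ltnNge leq_eqVlt; apply/norP; split.
      apply/eqP => xy; move: uniq_uv; rewrite cat_uniq => /and3P[_ /hasPn/(_ y yv)].
      by rewrite /= -xy xu.
    apply/negP => xy; case/andP: av => /occursPn/(_ [:: x; n; y]) H _.
    have /H/negP : subseq [:: x; n; y] (u ++ n :: v).
      by rewrite (@cat_subseq _ [:: x] [:: n; y]) //= ?eqxx sub1seq.
    by apply; apply: iso132; rewrite xy lt // mem_cat yv orbT.
  split=> //.
  - exact: subseq_avoiding (prefix_subseq _ _) av.
  - apply: subseq_avoiding av; apply: subseq_trans (suffix_subseq u _).
    exact: subseq_cons.
  - case: u => [|x u] in uv av lt uniq_uv ltvu *; [by left|right].
    have xu : x \in x :: u by rewrite inE eqxx.
    rewrite sorted_pairwise; last by move=> ? ? ? /=; lia.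
    have uniq_v : uniq v by move: uniq_uv; rewrite cat_uniq => /and3P[].
    apply: pairwise_subseq2 => y z yzv /=; rewrite ltnNge leq_eqVlt.
    apply/norP; split; first by have := subseq_uniq yzv uniq_v; rewrite /= inE andbT.
    apply/negP => yz; case/andP: av => _ /occursPn/(_ [:: x; n; y; z]) H.
    have zv : z \in v by apply: (mem_subseq yzv); rewrite !inE eqxx orbT.
    have /H/negP : subseq [:: x; n; y; z] ((x :: u) ++ n :: v).
      rewrite (@cat_subseq _ [:: x] [:: n; y; z]) ?sub1seq //.
      by rewrite -cat1s -[n :: v]cat1s cat_subseq.
    apply; apply: iso3412 => //; first exact: ltvu.
    by apply: lt; rewrite mem_cat xu.
apply/andP; split=> //.
have lt x : x \in u ++ v -> x < n by rewrite (perm_mem uv) mem_iota.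
by apply: avoiding_cat_max => // x xuv; apply: lt; rewrite mem_cat xuv ?orbT.
Qed.

(** * Sums over words with the maximum in a given position *)

(** Reindexing along a bijection: the last two hypotheses say that [f] maps [S] onto the words with
    [n] in position [k]. The maximum in first, last or inner position gives three instances. *)
Lemma sum_words_index (V : nmodType) n k (f : seq nat -> seq nat) (S : seq (seq nat))
    (G : seq nat -> V) :
  uniq S -> injective f ->
  (forall w, w \in S -> exists u v,
     [/\ f w = u ++ n :: v, size u = k & u ++ n :: v \in words n.+1]) ->
  (forall u v, size u = k -> u ++ n :: v \in words n.+1 ->
     exists2 w, w \in S & u ++ n :: v = f w) ->
  (\sum_(w <- words n.+1 | index n w == k) G w = \sum_(w <- S) G (f w))%R.
Proof.
move=> uS injf fS Sf; rewrite -big_filter -[RHS](big_map f xpredT G).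
apply: perm_big; apply: uniq_perm.
- exact/filter_uniq/words_uniq.
- by rewrite map_inj_uniq.
(* The letters are distinct, so [n] is not in [u]. *)
have idx u v : u ++ n :: v \in words n.+1 -> index n (u ++ n :: v) = size u.
  rewrite mem_words => /andP[/perm_uniq]; rewrite iota_uniq cat_uniq /= => /and3P[_].
  by rewrite negb_or => /andP[nu _] _; rewrite index_cat (negPf nu) /= eqxx addn0.
move=> w; rewrite mem_filter; apply/andP/mapP.
- move=> [/eqP wk ww].
  have nw : n \in w.
    by move: ww; rewrite mem_words => /andP[/perm_mem -> _]; rewrite mem_iota /=.
  case/splitPr: nw wk ww => u v wk ww.
  by apply: Sf; rewrite // -wk idx.
- by case=> u /fS[u1 [v1 [-> <- H]]] ->; rewrite idx.
Qed.

(** Since [v] lies below [u], sorting each and concatenating gives a sorted list. It must be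
    [iota 0 n], whose cut at [size v] identifies both halves. *)
Lemma perm_cat_iota n u v :
  (forall x y, x \in u -> y \in v -> y < x) -> perm_eq (u ++ v) (iota 0 n) ->
  perm_eq v (iota 0 (size v)) /\
  perm_eq u (map (addn (size v)) (iota 0 (size u))).
Proof.
move=> ltvu uv.
have E : sort leq v ++ sort leq u = iota 0 n.
  apply: (sorted_eq leq_trans anti_leq).
  - rewrite (sorted_pairwise leq_trans) pairwise_cat.
    rewrite -!(sorted_pairwise leq_trans) !(sort_sorted leq_total) !andbT.
    apply/allrelP => x y; rewrite !mem_sort => xv yu.
    exact/ltnW/ltvu.
  - exact: iota_sorted.
  - by apply: perm_trans uv; rewrite perm_catC perm_cat // perm_sort.
have sn : n = size v + size u by rewrite -(size_iota 0 n) -E size_cat !size_sort.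
move/eqP: E; rewrite sn iotaD add0n eqseq_cat ?size_sort ?size_iota //.
rewrite -iotaDl addn0 => /andP[/eqP <- /eqP <-].
by rewrite !(perm_sym _ (sort _ _)) !perm_sort.
Qed.

Lemma sorted_gtn_rev_iota n : sorted gtn (rev (iota 0 n)).
Proof. by rewrite rev_sorted; exact: iota_ltn_sorted. Qed.

Lemma sum_words_index0 (V : nmodType) n (G : seq nat -> V) :
  (\sum_(w <- words n.+1 | index n w == 0%N) G w
   = \sum_(w <- words n) G (n :: w))%R.
Proof.
apply: (sum_words_index (f := cons n)).
- exact: words_uniq.
- by move=> u v [].
- move=> w ww; exists [::], w; split=> //; apply/mem_words_cat.
  by move: ww; rewrite mem_words => /andP[pw aw]; split=> //;
    [exact: sorted_gtn_avoiding|left].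
- move=> u v /size0nil -> /mem_words_cat[pv _ av _ _]; exists v => //.
  by rewrite mem_words pv.
Qed.

Lemma sum_words_indexn (V : nmodType) n (G : seq nat -> V) :
  (\sum_(w <- words n.+1 | index n w == n) G w
   = \sum_(w <- words n) G (rcons w n))%R.
Proof.
apply: (sum_words_index (f := rcons^~ n)) => [|u v|w ww|u v su].
- exact: words_uniq.
- exact: rcons_injl.
- exists w, [::]; rewrite -cats1 (size_word ww); split=> //; apply/mem_words_cat.
  by move: ww; rewrite mem_words cats0 => /andP[pw aw]; split=> //;
    [exact: sorted_gtn_avoiding|right].
- move=> /mem_words_cat[puv au _ _ _].
  have v0 : v = [::].
    apply/eqP; rewrite -size_eq0 -(eqn_add2l (size u)) -size_cat (perm_size puv).
    by rewrite size_iota su addn0.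
  subst v; exists u; last by rewrite -cats1.
  by rewrite mem_words au -[u]cats0 puv.
Qed.

(** The shape forced by an inner maximum: for [w] of length [k], the prefix is [w] lifted above the
    [m] smallest letters, which follow the maximum in decreasing order. *)
Definition glue k m w : seq nat := map (addn m) w ++ (k + m) :: rev (iota 0 m).

(** Since [k] is positive, the prefix is nonempty and forces the suffix to decrease. The suffix is
    thus determined, and only the prefix, up to a shift by [m], remains free. *)
Lemma sum_words_index_inner (V : nmodType) k m (G : seq nat -> V) : 0 < k ->
  (\sum_(w <- words (k + m).+1 | index (k + m)%N w == k) G w
   = \sum_(w <- words k) G (glue k m w))%R.
Proof.
move=> k_gt0; apply: (sum_words_index (f := glue k m)) => [|u v|w ww|u v su].
- exact: words_uniq.
- move=> E; have suv : size u = size v.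
    by move/(congr1 size): E; rewrite /glue !size_cat !size_map; lia.
  move/eqP: E; rewrite /glue eqseq_cat ?size_map // => /andP[/eqP + _].
  exact/inj_map/addnI.
- exists (map (addn m) w), (rev (iota 0 m)).
  rewrite size_map (size_word ww); split=> //; apply/mem_words_cat.
  have ltk x : x \in w -> x < k by apply: ltn_word.
  move: ww; rewrite mem_words => /andP[pw aw]; split.
  + rewrite perm_catC addnC iotaD [0 + m]addnC iotaDl.
    rewrite perm_cat //; first by rewrite perm_rev.
    exact: perm_map.
  + by rewrite avoiding_map_add.
  + exact/sorted_gtn_avoiding/sorted_gtn_rev_iota.
  + by move=> x y /mapP[z /ltk ltz ->]; rewrite mem_rev mem_iota; lia.
  + by right; apply: sorted_gtn_rev_iota.
- move=> /mem_words_cat[puv au _ ltvu dec].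
  have sv : size v = m.
    by have := perm_size puv; rewrite size_cat size_iota su => /addnI.
  have [pv pu] := perm_cat_iota ltvu puv; rewrite sv su in pv pu.
  have v_dec : sorted gtn v by case: dec su k_gt0 => // -> <-.
  have Ev : v = rev (iota 0 m).
    apply: (@irr_sorted_eq _ gtn) v_dec (sorted_gtn_rev_iota m) _.
    - by move=> ? ? ? /=; lia.
    - by move=> ?; rewrite /= ltnn.
    - by move=> x; rewrite mem_rev; apply: perm_mem.
  (* All letters of [u] are at least [m], so truncated subtraction undoes the shift. *)
  have Eu : map (addn m) (map (subn^~ m) u) = u.
    rewrite -map_comp map_id_in // => x; rewrite (perm_mem pu) => /mapP[y _ ->] /=.
    by rewrite addKn.
  exists (map (subn^~ m) u); last by rewrite /glue Eu -Ev.
  rewrite mem_words -(avoiding_map_add m) Eu au andbT.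
  by apply: (perm_map_inj (@addnI m)); rewrite Eu.
Qed.

(** * Inversions of words *)

Fixpoint invs w : nat :=
  if w is x :: w' then count (fun y => y < x) w' + invs w' else 0.

Lemma invs_cat u v :
  invs (u ++ v) = invs u + invs v + \sum_(x <- u) count (fun y => y < x) v.
Proof.
elim: u => [|x u IHu] /=; first by rewrite big_nil addn0.
by rewrite big_cons IHu count_cat; lia.
Qed.

Lemma invs_map_add m w : invs (map (addn m) w) = invs w.
Proof.
elim: w => //= x w ->; rewrite count_map; congr (_ + _).
by apply: eq_count => y /=; rewrite ltn_add2l.
Qed.

Lemma count_all (T : Type) (a : pred T) (s : seq T) : all a s -> count a s = size s.
Proof. by rewrite all_count => /eqP. Qed.

(** Passing to [m.+1] prepends the letter [m], which exceeds the [m] others; the recursion is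
    Pascal's rule. *)
Lemma invs_rev_iota m : invs (rev (iota 0 m)) = 'C(m, 2).
Proof.
elim: m => // m IHm; rewrite -addn1 iotaD rev_cat /= IHm addn1 binS bin1 addnC.
congr (_ + _); rewrite count_all ?size_rev ?size_iota //.
by apply/allP => x; rewrite mem_rev mem_iota.
Qed.

Lemma invs_cons_max n w : w \in words n -> invs (n :: w) = n + invs w.
Proof.
move=> ww /=; rewrite count_all ?(size_word ww) //.
by apply/allP => x; apply: ltn_word.
Qed.

Lemma invs_rcons_max n w : w \in words n -> invs (rcons w n) = invs w.
Proof.
move=> ww; rewrite -cats1 invs_cat /= addn0 big_seq big1 ?addn0 // => x xw.
by have := ltn_word ww xw; case: ltngtP.
Qed.

(** The factor [k.+1] counts the [k] letters of the lifted prefix and the maximum, each above all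
    [m] letters of the suffix; the maximum forms no inversion with the prefix. *)
Lemma invs_glue k m w :
  w \in words k -> invs (glue k m w) = k.+1 * m + 'C(m, 2) + invs w.
Proof.
move=> ww; rewrite /glue invs_cat invs_map_add /= invs_rev_iota.
rewrite count_all ?size_rev ?size_iota; last first.
  by apply/allP => x; rewrite mem_rev mem_iota; lia.
rewrite big_map (eq_big_seq (fun=> m)) => [|x xw].
  by rewrite big_const_seq count_predT (size_word ww) iter_addn; lia.
have ltk := ltn_word ww xw; have -> : (k + m < m + x) = false by lia.
rewrite add0n count_all ?size_rev ?size_iota //.
by apply/allP => y; rewrite mem_rev mem_iota; lia.
Qed.
End Words.

(** * From permutations to their one-line words *)

Definition word n (s : 'S_n) : seq nat := [seq val (s i) | i <- enum 'I_n].

Lemma nth_permword n (s : 'S_n) (i : 'I_n) : nth 0%N (word s) i = s i.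
Proof.
by rewrite (nth_map i) ?size_enum_ord // nth_ord_enum.
Qed.

Lemma word_inj n : injective (@word n).
Proof.
move=> s1 s2 E; apply/permP => i; apply: val_inj.
by rewrite /= -!nth_permword E.
Qed.

Lemma perm_word n (s : 'S_n) : perm_eq (word s) (iota 0 n).
Proof.
rewrite -val_enum_ord /word (map_comp val s); apply: perm_map.
apply: uniq_perm => [||i].
- by rewrite map_inj_uniq ?enum_uniq //; apply: perm_inj.
- exact: enum_uniq.
rewrite [RHS]mem_enum; apply/mapP; exists (s^-1%g i); first by rewrite mem_enum.
by rewrite permKV.
Qed.

(** [word] is injective with values in a list of n! words, as many as ['S_n] has elements, so the
    inclusion is an equality. *)
Lemma perm_eq_words n : perm_eq [seq word s | s <- enum {: 'S_n}]
  (permutations (iota 0 n)).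
Proof.
have U : uniq [seq word s | s <- enum {: 'S_n}].
  by rewrite map_inj_uniq ?enum_uniq //; apply: word_inj.
apply: uniq_perm => //; first exact: permutations_uniq.
apply: (uniq_min_size U _ _).2 => [w /mapP[s _ ->]|].
  by rewrite mem_permutations perm_word.
by rewrite size_permutations ?iota_uniq // size_iota size_map -cardE card_Sn.
Qed.

Local Notation lt_ord n := (fun i j : 'I_n => (i < j)%N).

Lemma lt_ord_trans n : transitive (lt_ord n).
Proof. by move=> ? ? ?; apply: ltn_trans. Qed.

Lemma sorted_enum_ord n : sorted (lt_ord n) (enum 'I_n).
Proof. by have := iota_ltn_sorted 0 n; rewrite -val_enum_ord sorted_map. Qed.

Lemma inv_word n (s : 'S_n) : Defs.inv s = invs (word s).
Proof.
(* Stated for any increasing list of positions, so that induction on the list applies. *)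
have invs_map (g : 'I_n -> nat) (l : seq 'I_n) : sorted (lt_ord n) l ->
    invs (map g l) = (\sum_(x <- l) \sum_(y <- l) ((x < y) && (g y < g x)))%N.
  elim: l => [|x l IHl]; first by rewrite big_nil.
  rewrite /= (path_sortedE (@lt_ord_trans n)) => /andP[/allP xl sl].
  rewrite big_cons big_cons ltnn add0n; congr (_ + _)%N.
    rewrite count_map -sum1_count big_mkcond !big_seq; apply: eq_bigr => y yl /=.
    by rewrite xl //; case: ifP.
  rewrite (IHl sl) !big_seq; apply: eq_bigr => y /xl xy.
  by rewrite big_cons ltnNge ltnW.
rewrite /word (invs_map _ _ (sorted_enum_ord n)).
rewrite /Defs.inv cardsE -sum1_card big_enum /=.
under [RHS]eq_bigr do rewrite big_enum.
rewrite pair_big /=.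
rewrite big_mkcond /=; apply: eq_bigr => p _.
by rewrite unfold_in; case: ifP.
Qed.

(** Increasing position maps correspond to masks: [f] yields the word of values at its positions,
    and a mask yields the increasing list [l] of selected positions. *)
Lemma contains_patternE k (t : k.-tuple nat) n (s : 'S_n) :
  contains_pattern t s = occurs t (word s).
Proof.
apply/existsP/occursP => [[f /andP[/forallP f_lt /forallP f_iso]]|[u]].
  have flt (i j : 'I_k) : (i < j)%N -> (f i < f j)%N by apply/implyP/(forallP (f_lt i)).
  exists [seq val (s i) | i <- map f (enum 'I_k)].
    apply: map_subseq.
    (* The image of [f] is increasing, hence equals the filter of all positions by membership, and a
       filter is a subsequence. *)
    have -> : map f (enum 'I_k) = filter [in map f (enum 'I_k)] (enum 'I_n).
      apply: (@irr_sorted_eq _ (lt_ord n)); first exact: (@lt_ord_trans n).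
      - by move=> i; rewrite /= ltnn.
      - rewrite sorted_map; apply: (@sub_sorted _ (lt_ord k)).
          by move=> i j /=; apply: flt.
        by have := iota_ltn_sorted 0 k; rewrite -val_enum_ord sorted_map.
      - exact/(sorted_filter (@lt_ord_trans n))/sorted_enum_ord.
      - by move=> i; rewrite mem_filter mem_enum andbT.
    exact: filter_subseq.
  apply/order_isoP; rewrite 2!size_map size_enum_ord size_tuple; split=> // i j ltik ltjk.
  have E h (lth : (h < k)%N) :
      nth 0%N [seq val (s i) | i <- map f (enum 'I_k)] h = s (f (Ordinal lth)).
    rewrite -map_comp (nth_map (Ordinal lth)) ?size_enum_ord //=.
    by congr (val (s (f _))); apply: val_inj; exact: nth_enum_ord.
  have := eqP (forallP (f_iso (Ordinal ltik)) (Ordinal ltjk)).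
  by rewrite !(tnth_nth 0%N) !E.
case/subseqP=> m sm -> /order_isoP; rewrite -map_mask size_map size_tuple.
set l := mask m (enum 'I_n) => -[/eqP sl iso].
have l_lt : sorted (lt_ord n) l.
  exact/(subseq_sorted (@lt_ord_trans n) (mask_subseq _ _))/sorted_enum_ord.
exists [ffun i => tnth (Tuple sl) i]; apply/andP; split.
  apply/forallP => i; apply/forallP => j; apply/implyP => ij; rewrite !ffunE.
  (* [nth] needs a default in ['I_n]; the selected position at [i] supplies one. *)
  have x0 := tnth (Tuple sl) i; rewrite !(tnth_nth x0) /=.
  by apply: (sorted_ltn_nth (@lt_ord_trans n)) => //; rewrite inE (eqP sl).
apply/forallP => i; apply/forallP => j; rewrite !ffunE.
have x0 := tnth (Tuple sl) i; have := iso i j (ltn_ord i) (ltn_ord j).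
rewrite !(nth_map x0) ?(eqP sl) // !(tnth_nth 0%N t) => <-.
by rewrite !(tnth_nth x0).
Qed.

(** * The generating polynomial and its recurrence *)

Lemma F_W3_words n : F_W3 n = \sum_(w <- words n) 'X^(invs w).
Proof.
rewrite big_filter -(perm_big _ (perm_eq_words n)) /= big_map big_enum_cond /F_W3 /=.
apply: eq_big => [s|s _]; last by rewrite inv_word.
by rewrite !inE /avoids_pattern !contains_patternE.
Qed.

Theorem theorem6p3 :
  F_W3 1 = 1 /\
  forall n : nat, (2 <= n)%N ->
    F_W3 n = ('X^(n - 1) + 1) * F_W3 (n - 1) +
             \sum_(2 <= k < n) 'X^(k * (n - k) + 'C(n - k, 2)) * F_W3 (k - 1).
Proof.
split.
  rewrite F_W3_words /words (_ : permutations _ = [:: [:: 0%N]]) //=.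
  by rewrite sorted_gtn_avoiding // big_seq1.
(* The n of the statement is now [m.+1], and [m] is the largest letter. *)
case=> [|[|n]] // _; rewrite subn1 /=; set m := n.+1.
have m_gt0 : (0 < m)%N by [].
(* Words are grouped by the position of the maximum. [inord] puts this index into a finite type;
   [inordE] removes it again, the index being below [m.+1]. *)
rewrite F_W3_words (partition_big (fun w => inord (index m w) : 'I_m.+1) xpredT) //=.
have inordE (k : 'I_m.+1) : 
    \sum_(w <- words m.+1 | inord (index m w) == k) 'X^(invs w) =
    \sum_(w <- words m.+1 | index m w == k) 'X^(invs w) :> {poly int}.
  rewrite big_seq_cond [RHS]big_seq_cond; apply: eq_bigl => w.
  case ww: (_ \in _) => //=; rewrite -val_eqE /= inordK //.
  rewrite -(size_word ww) index_mem.
  by move: ww; rewrite mem_words => /andP[/perm_mem -> _]; rewrite mem_iota /=.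
rewrite (eq_bigr _ (fun k _ => inordE k)).
rewrite -(big_mkord xpredT
  (fun k => \sum_(w <- words m.+1 | index m w == k) 'X^(invs w))).
(* Positions [m] and 0 are split off; they give the terms 1 and q^m of the first factor. *)
rewrite big_nat_recr //= big_ltn // sum_words_index0 sum_words_indexn.
rewrite mulrDl mul1r addrAC; congr (_ + _ + _).
- rewrite F_W3_words mulr_sumr; apply: eq_big_seq => w ww.
  by rewrite invs_cons_max // exprD.
- by rewrite F_W3_words; apply: eq_big_seq => w ww; rewrite invs_rcons_max.
(* Position [k], counted from 0, corresponds to the index k + 1 of the statement, and the suffix has
   length [m - k]. *)
rewrite [RHS]big_add1 /=; apply: eq_big_nat => k /andP[k_gt0 ltkm].
rewrite subn1 /= F_W3_words mulr_sumr subSS.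
have Em : m = (k + (m - k))%N by rewrite subnKC // ltnW.
rewrite [in LHS]Em sum_words_index_inner //; apply: eq_big_seq => w ww.
by rewrite invs_glue // exprD.
Qed.
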